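(* Let $n\ge 3$. The model $Y_{\mathcal B(n-1)}$ is the supermaximal model associated with the root arrangement of type $A_{n-1}$; that is, $Y_{\mathcal B(n-1)}$ is the minimal model $Y_{\mathcal K}$ in the poset $\mathcal L$ that admits the $S_{n+1}$ action and such that $\mathcal K\supseteq\mathcal T$.
   Context: Irreducibles and nested sets. Let $\mathbb K=\mathbb R$ or $\mathbb C$ and $V=\{x\in\mathbb K^n:\sum_i x_i=0\}$, with its standard Euclidean/Hermitian product. For $I\subseteq\{1,\dots,n\}$, $|I|\ge2$, let $A_I$ be the span of all $e_i-e_j$, $i,j\in I$; put $\mathcal F=\mathcal F_{A_{n-1}}=\{A_I\}$, so $V=A_{\{1,\dots,n\}}\in\mathcal F$. A set $\mathcal S\subseteq\mathcal F$ is nested if for any $A_I,A_J\in\mathcal S$ either $I\cap J=\emptyset$ or one of $I,J$ contains the other. $\mathcal B(n-1)$ is the set of all nested sets containing $V$. Minimal model. Let $\mathcal M\subset V$ be the complement of the hyperplanes $x_i=x_j$. The minimal model $Y_{minA_{n-1}}$ is the closure of the image of $\mathbb P(\mathcal M)\to\mathbb P(V)\times\prod_{D\in\mathcal F\setminus\{V\}}\mathbb P(V/D^\perp)$ (inclusion and projections). Its boundary is a normal crossings divisor with irreducible components $\mathcal D_A$, $A\in\mathcal F\setminus\{V\}$, where $\mathcal D_A$ is the unique component whose image in $\mathbb P(V)$ is $\mathbb P(A^\perp)$. For $\mathcal S\in\mathcal B(n-1)$ the stratum $\mathcal D_{\mathcal S}=\bigcap_{A\in\mathcal S\setminus\{V\}}\mathcal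 D_A$ is smooth, irreducible, of codimension $|\mathcal S|-1$; these are all the strata. $S_{n+1}$ action. $Y_{minA_{n-1}}\cong\overline M_{0,n+1}$, so $S_{n+1}$ (permutations of $\{0,\dots,n\}$) acts on it. On strata this is given by $\sigma\cdot V=V$ and, for $A_I\ne V$, $\sigma\cdot A_I=A_{\sigma(I)}$ if $0\notin\sigma(I)$, $\sigma\cdot A_I=A_{\{0,\dots,n\}\setminus\sigma(I)}$ if $0\in\sigma(I)$, and $\sigma\mathcal S=\{\sigma\cdot A:A\in\mathcal S\}$. Models of the model. A subset $\mathcal K\subseteq\mathcal B(n-1)$ (with the convention $\{V\}\in\mathcal K$) is building if $\{\mathcal D_{\mathcal S}:\mathcal S\in\mathcal K\setminus\{\{V\}\}\}$ is a building set of strata: every boundary stratum of $Y_{minA_{n-1}}$ is the transversal intersection of the minimal elements of this family that contain it. (Equivalently: $\{V,A\}\in\mathcal K$ for all $A\in\mathcal F\setminus\{V\}$, and $\mathcal S\cup\mathcal T\in\mathcal K$ whenever $\mathcal S,\mathcal T\in\mathcal K$, $\mathcal S\cup\mathcal T$ is nested and $\mathcal S\cap\mathcal T\supsetneq\{V\}$.) For such $\mathcal K$, $Y_{\mathcal K}$ is the closure of the image of the open part of $Y_{minA_{n-1}}$ in $\prod_{\mathcal S\in\mathcal K\setminus\{\{V\}\}}Bl_{\mathcal D_{\mathcal S}}Y_{minA_{n-1}}$; equivalently it is the iterated blowup of $Y_{minA_{n-1}}$ along (the transforms of) the strata in $\mathcal K$, in order of increasing dimension. $Y_{\mathcal B(n-1)}$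 is the model obtained by blowing up all the strata. The poset $\mathcal L$. $\mathcal L$ is the family of all the models $Y_{\mathcal K}$ with $\mathcal K\subseteq\mathcal B(n-1)$ building, ordered by $Y_{\mathcal K_1}\le Y_{\mathcal K_2}$ iff $\mathcal K_1\subseteq\mathcal K_2$. A model $Y_{\mathcal K}\in\mathcal L$ admits the $S_{n+1}$ action if the $S_{n+1}$ action on $Y_{minA_{n-1}}$ lifts to $Y_{\mathcal K}$, i.e. $\mathcal K$ is closed under the $S_{n+1}$ action on $\mathcal B(n-1)$ given by $\sigma\mathcal S=\{\sigma\cdot A:A\in\mathcal S\}$, where $\sigma\cdot V=V$ and, for $A_I\ne V$, $\sigma\cdot A_I=A_{\sigma(I)}$ if $0\notin\sigma(I)$ and $\sigma\cdot A_I=A_{\{0,\dots,n\}\setminus\sigma(I)}$ if $0\in\sigma(I)$. The set $\mathcal T$. $\mathcal T$ is the set of elements of $\mathcal B(n-1)$ of depth $1$, i.e. the sets $\{V,A_{I_1},\dots,A_{I_k}\}$ with $k\ge1$, $I_j\neq\{1,\dots,n\}$, and $I_1,\dots,I_k$ pairwise disjoint. (Blowing up the strata in $\mathcal T$ gives the maximal De Concini–Procesi model of type $A_{n-1}$.) *)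

(* Defs.v *)
From HB Require Import structures.
From mathcomp Require Import all_boot all_order all_fingroup all_algebra.

Set Implicit Arguments.
Unset Strict Implicit.
Unset Printing Implicit Defensive.

Import GRing.Theory.

(* Indices live in 'I_n.+1 = {0, ..., n}, on which S_{n+1} acts; the            *)
(* coordinates of K^n are the nonzero indices.  The irreducible A_I is recorded *)
(* by its index set I, a set of at least two nonzero indices, and V is          *)
(* A_{1,...,n}.  [Aspace_sub] and [Aspace_inj] show that this loses nothing.    *)

Notation indices n := {set 'I_n.+1}.

Section Irreducibles.
Variable n : nat.
Implicit Types (I J : indices n) (S T : {set indices n}).

Definition Vtop : indices n := [set~ ord0].

Definition irreducible I : bool := (ord0 \notin I) && (1 < #|I|).

Definition nested S : bool :=
  [forall I in S, forall J in S,
     [|| [disjoint I & J], I \subset J | J \subset I]].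

(* B(n-1) *)
Definition nested_sets : {set {set indices n}} :=
  [set S : {set indices n} | [&& Vtop \in S, nested S & [forall I in S, irreducible I]]].

(* The set T: {V, A_{I_1}, ..., A_{I_k}} with k >= 1 and the I_j disjoint.      *)
Definition depth1_sets : {set {set indices n}} :=
  [set S in nested_sets | (S != [set Vtop]) &&
     [forall I in S :\ Vtop, forall J in S :\ Vtop,
        (I != J) ==> [disjoint I & J]]].

End Irreducibles.

Arguments Vtop {n}.

Section Subspaces.
Variables (K : fieldType) (n : nat).
Local Open Scope ring_scope.

(* A_I, with K^n seen as the hyperplane x_0 = 0 of K^{n+1}. *)
Definition Aspace (I : indices n) : {vspace 'rV[K]_n.+1} :=
  (\sum_(i in I) \sum_(j in I)
     <[delta_mx ord0 i - delta_mx ord0 j : 'rV[K]_n.+1]>)%VS.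

Lemma Aspace_sub (I J : indices n) :
  irreducible I -> (Aspace I <= Aspace J)%VS = (I \subset J).
Proof.
case/andP=> _ cI; apply/idP/idP; last first.
  move=> sIJ; apply/subv_sumP=> i iI; apply/subv_sumP=> j jI.
  apply: (subv_trans _ (sumv_sup i (subsetP sIJ _ iI) (subvv _))).
  exact: (sumv_sup j (subsetP sIJ _ jI) (subvv _)).
move=> sA; apply/subsetP=> i iI; apply: contraLR sA => iJ.
have [j /andP[jI ji]] : exists j, (j \in I) && (j != i).
  move: cI; rewrite (cardsD1 i) iI ltnS => /card_gt0P[j].
  by rewrite !inE andbC => jP; exists j.
apply/negP=> /subvP/(_ (delta_mx ord0 i - delta_mx ord0 j)).
have /[swap]/[apply] : delta_mx ord0 i - delta_mx ord0 j \in Aspace I.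
  rewrite memvE; apply: (sumv_sup i) => //; exact: (sumv_sup j).
case/memv_sumP=> u uP /matrixP/(_ ord0 i).
rewrite !mxE eqxx /= eqxx (negPf (_ : i != j)) 1?eq_sym // subr0 summxE big1.
  by move/eqP; rewrite oner_eq0.
move=> k kJ; case/memv_sumP: (uP k kJ) => w wP ->.
rewrite summxE big1 // => l lJ; case/vlineP: (wP l lJ) => a ->.
rewrite !mxE /=; case: (i =P k) => [ik|_]; first by rewrite ik kJ in iJ.
case: (i =P l) => [il|_]; first by rewrite il lJ in iJ.
by rewrite subr0 mulr0.
Qed.

Lemma Aspace_inj (I J : indices n) :
  irreducible I -> irreducible J -> Aspace I = Aspace J -> I = J.
Proof.
move=> hI hJ eqA; apply/eqP; rewrite eqEsubset -!Aspace_sub //.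
by rewrite eqA subvv.
Qed.

End Subspaces.

Section Building.
Variable n : nat.
Implicit Types (I J : indices n) (S T M : {set indices n})
  (K G : {set {set indices n}}).

(* The stratum D_S is represented by S.  Since D_S is the intersection of the   *)
(* D_A for A in S \ {V}:                                                        *)
(* - D_S is contained in D_T iff T is contained in S, so the minimal strata     *)
(*   containing D_S come from the maximal subsets of S;                         *)
(* - the intersection of the D_T, T in G, is the stratum of the union of G;     *)
(* - strata of a normal crossings divisor meet transversally iff the            *)
(*   codimension of their intersection is the sum of their codimensions.        *)

Definition codim S : nat := #|S|.-1.

Definition transversal_intersection S G : bool :=
  (S == \bigcup_(T in G) T) && (codim S == \sum_(T in G) codim T).

Definition minimal_strata_containing K S : {set {set indices n}} :=
  [set M | maxset (fun T => (T \in K :\ [set Vtop]) && (T \subset S)) M].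

Definition building K : bool :=
  [&& K \subset nested_sets n, [set Vtop] \in K
    & [forall S in nested_sets n :\ [set Vtop],
         transversal_intersection S (minimal_strata_containing K S)]].

End Building.

Section Building_closure.
Variable n : nat.
Implicit Types (I J : indices n) (S T M : {set indices n})
  (K G : {set {set indices n}}).

Lemma nested_setsP S :
  reflect [/\ Vtop \in S,
              forall I J, I \in S -> J \in S ->
                [|| [disjoint I & J], I \subset J | J \subset I]
            & forall I, I \in S -> irreducible I]
          (S \in nested_sets n).
Proof.
rewrite inE; apply: (iffP and3P) => -[VS nS iS]; split=> //.
- by move=> I J IS JS; move/forall_inP/(_ I IS)/forall_inP/(_ J JS): nS.
- exact/forall_inP.
- by apply/forall_inP=> I IS; apply/forall_inP=> J JS; apply: nS.
- exact/forall_inP.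
Qed.

Lemma nested_setsS S T :
  S \in nested_sets n -> T \subset S -> Vtop \in T -> T \in nested_sets n.
Proof.
case/nested_setsP=> _ nS iS /subsetP sTS VT; apply/nested_setsP; split=> //.
- by move=> I J /sTS IS /sTS JS; apply: nS.
- by move=> I /sTS; apply: iS.
Qed.

Lemma codimE S : Vtop \in S -> codim S = #|S :\ Vtop|.
Proof. by rewrite /codim (cardsD1 Vtop S) => ->. Qed.

(* When all members contain V, codimensions add up iff the members are          *)
(* pairwise disjoint away from V.                                               *)
Lemma transversal_intersectionP S G :
  Vtop \in S -> S != [set Vtop] ->
  (forall T, T \in G -> Vtop \in T /\ T != [set Vtop]) ->
  reflect (S = \bigcup_(T in G) T /\
           forall T M I, T \in G -> M \in G -> I != Vtop ->
             I \in T -> I \in M -> T = M)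
          (transversal_intersection S G).
Proof.
move=> VS SnV hG; set D := fun T => T :\ Vtop.
have injD : {in G &, injective D}.
  move=> T M /hG[VT _] /hG[VM _] eqD.
  by rewrite -(setD1K VT) -(setD1K VM) -!/(D _) eqD.
have sumE : \sum_(T in G) codim T = \sum_(A in D @: G) #|A|.
  by rewrite big_imset //=; apply: eq_bigr => T /hG[VT _]; rewrite codimE.
have covE : S = \bigcup_(T in G) T -> cover (D @: G) = S :\ Vtop.
  move=> ->; rewrite cover_imset; apply/setP=> I; rewrite !inE.
  apply/bigcupP/andP=> [[T TG]|[IV /bigcupP[T TG IT]]].
    by rewrite !inE => /andP[-> IT]; split=> //; apply/bigcupP; exists T.
  by exists T; rewrite // !inE IV.
apply: (iffP andP) => [[/eqP SE]|[SE dG]].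
  rewrite codimE // sumE -covE // (leq_card_cover _) => /trivIsetP tG.
  split=> // T M I TG MG IV IT IM; apply: contraTeq isT => neqTM.
  have /tG : D T \in D @: G by apply: imset_f.
  move/(_ (D M) (imset_f _ MG)); rewrite (inj_in_eq injD) // neqTM.
  move/(_ isT)/pred0P/(_ I); rewrite /= !inE IV IT IM.
  by [].
split; first exact/eqP.
rewrite codimE // sumE -covE // (leq_card_cover _).
apply/trivIsetP=> _ _ /imsetP[T TG ->] /imsetP[M MG ->] neqD.
apply/pred0P=> I; apply/negP=> /= /andP[].
rewrite !inE => /andP[IV IT] /andP[_ IM].
by rewrite (dG T M I) ?eqxx in neqD.
Qed.

(* The equivalent description of building sets as families closed under         *)
(* overlapping unions.                                                          *)
Lemma buildingP K :
  reflect
    [/\ K \subset nested_sets n, [set Vtop] \in K,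
        forall I, irreducible I -> I != Vtop -> [set Vtop; I] \in K
      & forall S T, S \in K -> T \in K -> S :|: T \in nested_sets n ->
          [set Vtop] \proper S :&: T -> S :|: T \in K]
    (building K).
Proof.
apply: (iffP and3P) => [[sKB VK /forall_inP tK]|[sKB VK atK unK]].
  have VinK S : S \in K -> Vtop \in S.
    by move/(subsetP sKB)/nested_setsP=> [].
  have tP S : S \in nested_sets n -> S != [set Vtop] ->
    let G := minimal_strata_containing K S in
    [/\ forall M, M \in G -> M \in K /\ M \subset S, S = \bigcup_(T in G) T
      & forall T M I, T \in G -> M \in G -> I != Vtop ->
             I \in T -> I \in M -> T = M].
    move=> SB SnV G.
    have hG M : M \in G -> [/\ M \in K, M != [set Vtop] & M \subset S].
      by rewrite inE => /maxsetp; rewrite !inE => /andP[/andP[-> ->] ->].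
    have tSG : transversal_intersection S G by apply: tK; rewrite in_setD1 SnV.
    have VS : Vtop \in S by case/nested_setsP: SB.
    have hG' M : M \in G -> Vtop \in M /\ M != [set Vtop] by case/hG=> /VinK.
    have [SE dG] := transversal_intersectionP VS SnV hG' tSG.
    by split=> // M /hG[].
  split=> //.
    move=> I iI IV.
    have nB : [set Vtop; I] \in nested_sets n.
      have sIV : I \subset Vtop.
        by apply/subsetP=> i; rewrite !inE; case/andP: iI => I0 _;
           apply: contraTneq => ->.
      have /nested_setsP[_ _ /(_ _ (set11 _)) iV] := subsetP sKB _ VK.
      apply/nested_setsP; split; first by rewrite !inE eqxx.
        by move=> J1 J2; rewrite !inE;
           do 2![case/orP=> /eqP->]; rewrite ?subxx ?sIV ?orbT.
      by move=> J; rewrite !inE => /orP[]/eqP->.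
    have nV : [set Vtop; I] != [set Vtop].
      apply/eqP=> /setP/(_ I); rewrite !inE eqxx orbT => /esym/eqP E.
      by rewrite E eqxx in IV.
    have [hG SE _] := tP _ nB nV.
    have : I \in [set Vtop; I] by rewrite !inE eqxx orbT.
    rewrite {1}SE => /bigcupP[T TG IT].
    have [TK sT] := hG _ TG; suff -> : [set Vtop; I] = T by [].
    apply/eqP; rewrite eqEsubset sT andbT subUset !sub1set IT.
    by rewrite VinK.
  move=> S T SK TK nST /properP[_ [I]].
  rewrite in_setI in_set1 => /andP[IS IT] IV.
  have ne M : I \in M -> M != [set Vtop].
    by apply: contraTneq => ->; rewrite inE.
  have nV : S :|: T != [set Vtop] by apply: ne; rewrite inE IS.
  have [hG SE dG] := tP _ nST nV.
  have ext M : M \in K -> I \in M -> M \subset S :|: T ->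
      exists2 M', M' \in minimal_strata_containing K (S :|: T) & M \subset M'.
    move=> MK IM sM.
    have [|M' M'P sMM'] := @maxset_exists _
      (fun T0 => (T0 \in K :\ [set Vtop]) && (T0 \subset S :|: T)) M.
      by rewrite !inE MK sM ne.
    by exists M'; rewrite ?inE.
  have [M1 M1G sS] := ext S SK IS (subsetUl _ _).
  have [M2 M2G sT] := ext T TK IT (subsetUr _ _).
  have E : M1 = M2.
    exact: (dG _ _ _ M1G M2G IV (subsetP sS _ IS) (subsetP sT _ IT)).
  rewrite -E in sT; have [M1K sM1] := hG _ M1G.
  suff -> : S :|: T = M1 by [].
  by apply/eqP; rewrite eqEsubset sM1 subUset sS sT.
have VB := subsetP sKB _ VK.
split=> //; apply/forall_inP=> S; rewrite in_setD1 => /andP[SnV SB].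
have [VS nS iS] := nested_setsP _ SB.
have VinK M : M \in K -> Vtop \in M.
  by move/(subsetP sKB)/nested_setsP=> [].
have hG M : M \in minimal_strata_containing K S ->
    [/\ M \in K, M != [set Vtop] & M \subset S].
  by rewrite inE => /maxsetp; rewrite !inE => /andP[/andP[-> ->] ->].
have up I : I \in S -> I != Vtop ->
    exists2 M, M \in minimal_strata_containing K S & I \in M.
  move=> IS IV.
  have [|M MP sM] := @maxset_exists _
    (fun T0 => (T0 \in K :\ [set Vtop]) && (T0 \subset S)) [set Vtop; I].
    rewrite !inE atK ?iS //= subUset !sub1set VS IS !andbT.
    apply/eqP=> /setP/(_ I); rewrite !inE eqxx orbT => /esym/eqP E.
    by rewrite E eqxx in IV.
  exists M; first by rewrite inE.
  by apply: (subsetP sM); rewrite !inE eqxx orbT.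
apply/transversal_intersectionP => //.
  by move=> T /hG[/VinK].
split.
  apply/eqP; rewrite eqEsubset; apply/andP; split; last first.
    by apply/bigcupsP=> M /hG[].
  apply/subsetP=> I IS; have [->|IV] := eqVneq I Vtop; last first.
    by have [M MG IM] := up I IS IV; apply/bigcupP; exists M.
  have [J JS JV] : exists2 J, J \in S & J != Vtop.
    apply/exists_inP; apply: contraNT SnV; rewrite negb_exists_in.
    move/forall_inP=> h; rewrite eqEsubset sub1set VS andbT.
    by apply/subsetP=> J /h; rewrite negbK inE.
  have [M MG _] := up J JS JV; apply/bigcupP; exists M => //.
  by have [/VinK] := hG _ MG.
move=> T M I TG MG IV IT IM.
have [TK TV sT] := hG _ TG; have [MK MV sM] := hG _ MG.
have sTM : T :|: M \subset S by rewrite subUset sT sM.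
have VTM : Vtop \in T :|: M by rewrite inE VinK.
have TMK : T :|: M \in K.
  apply: unK => //; first exact: nested_setsS SB sTM VTM.
  apply/properP; split; first by rewrite sub1set inE !VinK.
  by exists I; rewrite inE ?IT ?IM.
have TMV : T :|: M != [set Vtop].
  apply/eqP=> E; have : I \in T :|: M by rewrite inE IT.
  by rewrite E inE (negPf IV).
have hTM : (T :|: M \in K :\ [set Vtop]) && (T :|: M \subset S).
  by rewrite !inE TMV TMK sTM.
move: TG MG; rewrite !inE => /maxsetP[_ maxT] /maxsetP[_ maxM].
by rewrite -(maxT _ hTM (subsetUl _ _)) (maxM _ hTM (subsetUr _ _)).
Qed.

End Building_closure.

Section Models.
Variable n : nat.
Implicit Types (I : indices n) (S : {set indices n}).

(* The poset of models: Y_K is given by its building set K, and the order is    *)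
(* inclusion of building sets.                                                  *)
Record model := Y { centers : {set {set indices n}}; _ : building centers }.

HB.instance Definition _ := [isSub for centers].
HB.instance Definition _ := [Finite of model by <:].

Definition model_le (Y1 Y2 : model) : bool := centers Y1 \subset centers Y2.

Lemma model_le_refl : reflexive model_le.
Proof. by move=> Y1; apply: subxx. Qed.

Lemma model_le_anti : antisymmetric model_le.
Proof. by move=> Y1 Y2; rewrite /model_le -eqEsubset => /eqP/val_inj. Qed.

Lemma model_le_trans : transitive model_le.
Proof. by move=> Y2 Y1 Y3; apply: subset_trans. Qed.

Fact model_display : Order.disp_t. Proof. exact: Order.Disp tt tt. Qed.

HB.instance Definition _ := Order.Le_isPOrder.Build model_display model
  model_le_refl model_le_anti model_le_trans.

Definition act_index (s : {perm 'I_n.+1}) I : indices n :=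
  if I == Vtop then Vtop
  else if ord0 \notin s @: I then s @: I else ~: (s @: I).

Definition act_nested (s : {perm 'I_n.+1}) S : {set indices n} :=
  act_index s @: S.

Definition admits_action (Y1 : model) : Prop :=
  forall (s : {perm 'I_n.+1}) S,
    S \in centers Y1 -> act_nested s S \in centers Y1.

Definition above_depth1 (Y1 : model) : Prop :=
  depth1_sets n \subset centers Y1.

(* The minimal (that is, least) model admitting the S_{n+1} action whose        *)
(* building set contains all nested sets of depth 1.                            *)
Definition supermaximal (Y1 : model) : Prop :=
  [/\ admits_action Y1, above_depth1 Y1
    & forall Y2 : model, admits_action Y2 -> above_depth1 Y2 ->
        (Y1 <= Y2)%O].

End Models.

(* Main.v *)
Require Import Defs.
From mathcomp Require Import all_boot all_fingroup.

Set Implicit Arguments.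
Unset Strict Implicit.
Unset Printing Implicit Defensive.

(** Nested sets are best seen as systems of compatible splits.  Attach to an
    irreducible I other than V the split of {0, ..., n} into I and its complement;
    then S_{n+1} acts on splits in the obvious way, and [act_index] names each
    split by its part without 0.  Two irreducibles are nested exactly when their
    splits are compatible ([compatible_ord0]), a condition that does not depend on
    which parts name the splits ([compatibleC]).  Hence the family of all nested
    sets is closed under the action ([act_nested_sets]).  It is building
    ([building_nested_sets]), because a union is only required to belong to a
    building family when it is nested.

    What remains is that a building set K that is closed under the action and
    contains the nested sets of depth 1 contains every nested set S.
    - If S has at most one element besides V, this is part of being building.
    - If S = {V, I, J} with I and J disjoint, then S has depth 1.
    - If S = {V, I, J} with I strictly contained in J, the transposition of 0
      with an element of J outside I fixes I and moves 0 across the split of J,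
      so it carries S to a nested set of depth 1 ([proper_pair_act]).
    - If S has three elements I, J, L besides V, then S \ {I} and S \ {J} are in
      K by induction on the cardinal, they share L, and their union is S; a
      building set is closed under such overlapping unions
      ([nested_sets_subset]).
    The group action is thus needed for chains of length two only. *)

(** * Splits of the index set *)

(** Two splits are compatible when one of the four intersections of a part of
    the first with a part of the second is empty; written with inclusions, the
    condition visibly treats a set and its complement alike. *)
Definition compatible (T : finType) (A B : {set T}) : bool :=
  [|| A \subset ~: B, A \subset B, ~: A \subset ~: B | ~: A \subset B].

Lemma compatible_sym (T : finType) (A B : {set T}) :
  compatible A B = compatible B A.
Proof.
rewrite /compatible !setCS -[A \subset ~: B]setCS -[~: A \subset B]setCS !setCK.
by do !case: (_ \subset _).
Qed.

Lemma compatibleC (T : finType) (A B : {set T}) :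
  compatible (~: A) B = compatible A B.
Proof. by rewrite /compatible setCK; do !case: (_ \subset _). Qed.

Lemma imset_permC (T : finType) (s : {perm T}) (A : {set T}) :
  s @: (~: A) = ~: (s @: A).
Proof.
apply/setP=> x; rewrite -(permKV s x) inE !(mem_imset _ _ perm_inj).
by rewrite inE.
Qed.

Lemma compatible_imset (T : finType) (s : {perm T}) (A B : {set T}) :
  compatible A B -> compatible (s @: A) (s @: B).
Proof.
rewrite /compatible -!imset_permC.
by case/or4P=> /(imsetS s) ->; rewrite ?orbT.
Qed.

Section NestedSets.
Variable n : nat.
Implicit Types (I J : indices n) (S : {set indices n}).
Implicit Types (K : {set {set indices n}}) (s : {perm 'I_n.+1}).

(** The parts of two splits that contain 0 always meet, which rules out one of the
    four ways of being compatible. *)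
Lemma compatible_ord0 I J : ord0 \notin I -> ord0 \notin J ->
  compatible I J = [|| [disjoint I & J], I \subset J | J \subset I].
Proof.
move=> I0 J0; rewrite /compatible setCS disjoints_subset.
suff /negPf-> : ~~ (~: I \subset J) by rewrite orbF.
by apply/subsetPn; exists ord0; rewrite // inE.
Qed.

Lemma irreducible_subV I : irreducible I -> I \subset Vtop.
Proof. by case/andP=> I0 _; rewrite /Vtop -setCS setCK sub1set inE. Qed.

Lemma irreducibleV I : irreducible I -> irreducible (Vtop : indices n).
Proof.
move=> iI; rewrite /irreducible /Vtop !inE eqxx /=.
have /andP[_ /leq_trans->] := iI; rewrite // subset_leq_card //.
exact: irreducible_subV.
Qed.

(** Only the split of V has a one-element part, so the part containing 0 of any
    other split can become the index set of an irreducible. *)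
Lemma irreducible_card_setC I : irreducible I -> I != Vtop -> 1 < #|~: I|.
Proof.
move=> iI IV; rewrite ltnNge; apply: contra IV => cI.
rewrite eqEsubset irreducible_subV //= /Vtop -setCS setCK.
have I0 : [set ord0] \subset ~: I by rewrite sub1set inE; case/andP: iI.
by move: (subset_leqif_card I0) => /geq_leqif; rewrite cards1 cI => <-.
Qed.

(** V contains every irreducible, so only the other members have to be compared
    with each other. *)
Lemma nested_sets_neqV S : Vtop \in S -> {in S, forall I, irreducible I} ->
  {in S &, forall I J, I != Vtop -> J != Vtop ->
    [|| [disjoint I & J], I \subset J | J \subset I]} ->
  S \in nested_sets n.
Proof.
move=> VS iS nS; apply/nested_setsP; split=> // I J IS JS.
have [->|IV] := eqVneq I Vtop; first by rewrite (irreducible_subV (iS J JS)) !orbT.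
have [->|JV] := eqVneq J Vtop; first by rewrite (irreducible_subV (iS I IS)) !orbT.
exact: nS.
Qed.

(** * The action of the symmetric group on nested sets *)

Lemma act_index_irreducible s I : irreducible I -> irreducible (act_index s I).
Proof.
move=> iI; rewrite /act_index; case: eqP => [<- //|/eqP IV].
case: ifPn => [I0|]; rewrite /irreducible.
  by rewrite I0 card_imset; [case/andP: iI | apply: perm_inj].
rewrite negbK inE => ->; rewrite -imset_permC card_imset; last exact: perm_inj.
exact: irreducible_card_setC.
Qed.

Lemma act_index_compatible s I J : I != Vtop -> J != Vtop ->
  compatible I J -> compatible (act_index s I) (act_index s J).
Proof.
move=> IV JV /(compatible_imset s) cIJ; rewrite /act_index.
rewrite (negPf IV) (negPf JV).
by do 2!case: ifP => _; rewrite ?compatibleC // compatible_sym ?compatibleC //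
  compatible_sym.
Qed.

Lemma act_nested_sets s S :
  S \in nested_sets n -> act_nested s S \in nested_sets n.
Proof.
case/nested_setsP=> VS nS iS.
have VE : act_index s Vtop = Vtop by rewrite /act_index eqxx.
apply: nested_sets_neqV; first by rewrite -VE imset_f.
- by move=> _ /imsetP[I IS ->]; apply/act_index_irreducible/iS.
move=> _ _ /imsetP[I IS ->] /imsetP[J JS ->] IV JV.
have [/andP[I0 _] /andP[J0 _]] := (iS I IS, iS J JS).
have /andP[sI0 _] := act_index_irreducible s (iS I IS).
have /andP[sJ0 _] := act_index_irreducible s (iS J JS).
rewrite -compatible_ord0 //; apply: act_index_compatible.
- by apply: contraNneq IV => ->; rewrite VE.
- by apply: contraNneq JV => ->; rewrite VE.
- by rewrite compatible_ord0 ?nS.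
Qed.

(** * Building sets of nested sets *)

Lemma building_nested_sets : 1 < n -> building (nested_sets n).
Proof.
move=> n_gt1; have iV : irreducible (Vtop : indices n).
  by rewrite /irreducible /Vtop cardsC1 card_ord !inE eqxx.
apply/buildingP; split=> // [|I iI IV].
  apply: nested_sets_neqV; first exact: set11.
    by move=> I /set1P->.
  by move=> I J /set1P-> _ /eqP.
apply: nested_sets_neqV; first exact: set21.
  by move=> J /set2P[]->.
by move=> J1 J2 /set2P[]-> /set2P[]->; rewrite ?subxx ?orbT ?eqxx.
Qed.

Lemma disjoint_pair_depth1 I J :
  irreducible I -> irreducible J -> I != Vtop -> [disjoint I & J] -> [set Vtop; I; J] \in depth1_sets n.
Proof.
move=> iI iJ IV dIJ; have iV := irreducibleV iI.
set S := [set Vtop; I; J].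
have d L M : L \in S -> M \in S -> L != Vtop -> M != Vtop -> L != M ->
    [disjoint L & M].
  rewrite !inE -!orbA => /or3P[]/eqP-> /or3P[]/eqP->; rewrite ?eqxx //.
  by rewrite disjoint_sym.
have SB : S \in nested_sets n.
  apply: nested_sets_neqV; first by rewrite !inE eqxx.
    by move=> L; rewrite !inE -orbA => /or3P[]/eqP->.
  move=> L M LS MS LV MV; have [->|LM] := eqVneq L M; first by rewrite subxx !orbT.
  by rewrite d.
rewrite [S \in depth1_sets n]inE SB andTb; apply/andP; split.
  by apply: contraNneq IV => SE; rewrite -in_set1 -SE !inE eqxx orbT.
apply/forall_inP=> L /setD1P[LV LS]; apply/forall_inP=> M /setD1P[MV MS].
by apply/implyP; apply: d.
Qed.

(** Take s to be the transposition of 0 with an element j of J outside I.  It fixes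
    I, which contains neither 0 nor j, and brings 0 into the image of J; the part
    without 0 of the image split is then the complement of a set containing I. *)
Lemma proper_pair_act I J :
  irreducible I -> irreducible J -> I \proper J -> J != Vtop ->
  exists (s : {perm 'I_n.+1}) (J' : indices n),
    [/\ irreducible J', [disjoint I & J']
      & act_nested s [set Vtop; I; J'] = [set Vtop; I; J]].
Proof.
move=> iI iJ /properP[sIJ [j jJ jI]] JV.
have [/andP[I0 _] /andP[J0 _]] := (iI, iJ).
have IV : I != Vtop.
  apply: contraNneq JV => IE; rewrite eqEsubset irreducible_subV //.
  by rewrite -IE.
pose s := tperm ord0 j.
have sI : s @: I = I.
  rewrite -[RHS]imset_id; apply: eq_in_imset => i iI'.
  by rewrite tpermD //; apply: contraTneq iI' => <-.
have s0J : ord0 \in s @: J by rewrite -(tpermR ord0 j) imset_f.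
have sJ : act_index s J = ~: (s @: J) by rewrite /act_index (negPf JV) s0J.
have sK (A : indices n) : s @: (s @: A) = A.
  rewrite -imset_comp -[RHS]imset_id; apply: eq_imset => i /=.
  exact: tpermK.
exists s, (act_index s J); split.
- exact: act_index_irreducible.
- by rewrite disjoints_subset sJ setCK -sI imsetS.
have J'V : ~: (s @: J) != Vtop.
  rewrite /Vtop (inj_eq (@setC_inj _)); apply/eqP => E.
  have := iJ; rewrite /irreducible -(card_imset _ (@perm_inj _ s)) E cards1.
  by rewrite andbF.
have J'J : act_index s (~: (s @: J)) = J.
  by rewrite /act_index (negPf J'V) imset_permC sK setCK inE J0.
rewrite /act_nested !imsetU !imset_set1 sJ J'J.
by rewrite /act_index eqxx (negPf IV) sI I0.
Qed.

Lemma nested_pair_mem K I J :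
  (forall s S, S \in K -> act_nested s S \in K) -> depth1_sets n \subset K ->
  irreducible I -> irreducible J -> I != Vtop -> J != Vtop -> I != J ->
  [|| [disjoint I & J], I \subset J | J \subset I] -> [set Vtop; I; J] \in K.
Proof.
move=> actK depth1K.
have disjK L M : irreducible L -> irreducible M -> L != Vtop ->
    [disjoint L & M] -> [set Vtop; L; M] \in K.
  by move=> *; apply: (subsetP depth1K); apply: disjoint_pair_depth1.
have properK L M : irreducible L -> irreducible M -> M != Vtop ->
    L \proper M -> [set Vtop; L; M] \in K.
  move=> iL iM MV LM.
  have [s [M' [iM' dM' <-]]] := proper_pair_act iL iM LM MV.
  apply/actK/disjK => //; apply: contraTneq LM => ->.
  by rewrite properE (irreducible_subV iM) andbF.
move=> iI iJ IV JV IJ /or3P[dIJ|sIJ|sJI]; first exact: disjK.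
  by apply: properK; rewrite ?properEneq ?IJ.
rewrite setUAC; apply: properK => //.
by rewrite properEneq eq_sym IJ.
Qed.

(** Induction on the cardinal: as soon as S has three members besides V, removing
    either of two of them leaves sets that overlap in the third. *)
Lemma nested_sets_subset K :
  building K -> (forall s S, S \in K -> act_nested s S \in K) ->
  depth1_sets n \subset K -> nested_sets n \subset K.
Proof.
move=> /buildingP[_ VK atomK unionK] actK depth1K.
apply/subsetP=> S; have [m] := ubnP #|S|; elim: m S => // m IH S ltSm SB.
have [VS nS iS] := nested_setsP _ SB.
have [SV|[I]] := set_0Vmem (S :\ Vtop); first by rewrite -(setD1K VS) SV setU0.
move=> /setD1P[IV IS].
have [SI|[J]] := set_0Vmem (S :\ Vtop :\ I).
  suff -> : S = [set Vtop; I] by apply: atomK => //; apply: iS.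
  by rewrite -(setD1K VS) -(setD1K (_ : I \in S :\ Vtop)) ?SI ?setU0 // !inE IV.
move=> /setD1P[JI /setD1P[JV JS]].
have [SIJ|[L]] := set_0Vmem (S :\ Vtop :\ I :\ J).
  suff -> : S = [set Vtop; I; J].
    apply: nested_pair_mem => //; [exact: iS | exact: iS | | exact: nS].
    by rewrite eq_sym.
  rewrite -(setD1K VS) -(setD1K (_ : I \in S :\ Vtop)) ?inE ?IV //.
  by rewrite -(setD1K (_ : J \in S :\ Vtop :\ I)) ?inE ?JI ?JV // SIJ setU0 setUA.
move=> /setD1P[LJ /setD1P[LI /setD1P[LV LS]]].
have VSD X : X != Vtop -> Vtop \in S :\ X by move=> XV; rewrite !inE eq_sym XV.
have dropK X : X \in S -> X != Vtop -> S :\ X \in K.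
  move=> XS XV; apply: IH; last exact: nested_setsS SB (subD1set _ _) (VSD X XV).
  by move: ltSm; rewrite (cardsD1 X) XS.
have SE : (S :\ I) :|: (S :\ J) = S.
  by rewrite -setDIr (_ : [set I] :&: [set J] = set0) ?setD0 //;
     apply/setP=> X; rewrite !inE; case: eqP => // ->; rewrite eq_sym (negPf JI).
rewrite -SE; apply: unionK; rewrite ?dropK ?SE //.
apply/properP; split; first by rewrite sub1set inE !VSD.
by exists L; rewrite !inE ?LI ?LJ ?LS.
Qed.

End NestedSets.

Theorem theorem7p1 (n : nat) (hn : 3 <= n) :
  exists YB : model n, centers YB = nested_sets n /\ supermaximal YB.
Proof.
exists (Y (building_nested_sets (ltnW hn))); split=> //; split.
- by move=> s S; apply: act_nested_sets.
- by apply/subsetP=> S; rewrite inE => /andP[].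
- by case=> K bK actK depth1K; apply: nested_sets_subset.
Qed.
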